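(* Let $d\geq 1$ and let $S_{\boldsymbol{A}}:\ell(\mathbb{Z})^2\to\ell(\mathbb{Z})^2$ be a subdivision operator with mask $\boldsymbol{A}\in\ell(\mathbb{Z})^{2\times 2}_0$ satisfying the spectral condition of order $d$. Then for $n=1,\ldots,d$ there exist subdivision operators $S_{\boldsymbol{B}^{[n]}}$ (with masks $\boldsymbol{B}^{[n]}\in\ell(\mathbb{Z})^{2\times 2}_0$) such that $$\mathscr{G}^{[n]}S_{\boldsymbol{A}}=2^{-n}S_{\boldsymbol{B}^{[n]}}\mathscr{G}^{[n]},\qquad n=1,\ldots,d,$$ where $\mathscr{G}^{[n]}$ is the $n$-th Gregory operator.
   Context: $\ell(\mathbb{Z})^2$ is the space of all sequences $\mathbf{c}=(\mathbf{c}_j:j\in\mathbb{Z})$ with values in $\mathbb{R}^2$; $\ell(\mathbb{Z})^{2\times2}_0$ is the space of finitely supported sequences of real $2\times2$ matrices indexed by $\mathbb{Z}$. The subdivision operator with mask $\boldsymbol{A}\in\ell(\mathbb{Z})^{2\times2}_0$ is $S_{\boldsymbol{A}}:\ell(\mathbb{Z})^2\to\ell(\mathbb{Z})^2$, $(S_{\boldsymbol{A}}\mathbf{c})_j=\sum_{k\in\mathbb{Z}}\boldsymbol{A}_{j-2k}\mathbf{c}_k$, $j\in\mathbb{Z}$. A function $f$ on $\mathbb{R}$ is identified with the sequence $(f(j):j\in\mathbb{Z})$ when an operator on sequences is applied to it. $D$ denotes differentiation, $Df=f'$. $\Pi_k$ is the set of real polynomials of degree $\le k$, and $\pi[j]$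 denotes the coefficient of $x^j$ in the polynomial $\pi$. Spectral condition of order $d$ ($d\ge1$): there exist polynomials $\mathscr{P}_k\in\Pi_k$ with $\mathscr{P}_k[k]=1/k!$ such that $S_{\boldsymbol{A}}\begin{bmatrix}\mathscr{P}_k\\ D\mathscr{P}_k\end{bmatrix}=2^{-k}\begin{bmatrix}\mathscr{P}_k\\ D\mathscr{P}_k\end{bmatrix}$ for $k=0,\ldots,d$. Forward difference: $(\Delta c)_j=c_{j+1}-c_j$ on sequences; $\Delta^0=\mathrm{id}$, $\Delta^n=\Delta(\Delta^{n-1})$. Gregory coefficients: $G_n=\frac{1}{n!}\sum_{j=0}^n\genfrac{[}{]}{0pt}{}{n}{j}\frac{(-1)^{n-j}}{j+1}$, $n\ge 0$, where the Stirling numbers of the first kind $\genfrac{[}{]}{0pt}{}{n}{m}$ are given by $\genfrac{[}{]}{0pt}{}{0}{0}=1$, $\genfrac{[}{]}{0pt}{}{n}{0}=\genfrac{[}{]}{0pt}{}{0}{n}=0$ for $n\ge1$, and $\genfrac{[}{]}{0pt}{}{n+1}{m}=n\genfrac{[}{]}{0pt}{}{n}{m}+\genfrac{[}{]}{0pt}{}{n}{m-1}$ for $m\ge1$. The $n$-th Gregory operator ($n\ge1$) is $\mathscr{G}^{[n]}:\ell(\mathbb{Z})^2\to\ell(\mathbb{Z})^2$, $$\mathscr{G}^{[n]}=\begin{bmatrix}0&\Delta^n\\ \Delta&-\sum_{\ell=0}^{n-1}G_\ell\Delta^\ell\end{bmatrix}.$$ *)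

(* Defs.v *)
From HB Require Import structures.
From mathcomp Require Import all_boot all_order all_algebra.
From mathcomp Require Import classical_sets cardinality fsbigop reals.

Set Implicit Arguments.
Unset Strict Implicit.
Unset Printing Implicit Defensive.

Import Order.TTheory GRing.Theory Num.Theory.
Local Open Scope classical_set_scope.
Local Open Scope ring_scope.

Definition vec2 (R : realType) (a b : R) : 'cV[R]_2 :=
  \col_(i < 2) if i == 0 then a else b.

Definition finitely_supported (R : realType) (A : int -> 'M[R]_2) : Prop :=
  finite_set [set j | A j != 0].

(* The sum over [k] has finitely many nonzero terms as soon as [A] is finitely
   supported; for other masks, the library's convention for infinitely many
   nonzero terms makes it 0. *)
Definition subdivision (R : realType) (A : int -> 'M[R]_2)
    (c : int -> 'cV[R]_2) : int -> 'cV[R]_2 :=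
  fun j => \sum_(k \in [set: int]) (A (j - 2 * k) *m c k).

(* The sequence [p; p'] of samples on the integers. *)
Definition hermite_samples (R : realType) (p : {poly R}) : int -> 'cV[R]_2 :=
  fun j => vec2 p.[j%:~R] p^`().[j%:~R].

Definition spectral_condition (R : realType) (A : int -> 'M[R]_2) (d : nat) :
    Prop :=
  exists P : nat -> {poly R}, forall k : nat, (k <= d)%N ->
    [/\ (size (P k) <= k.+1)%N,
        (P k)`_k = (k`!%:R)^-1 &
        forall j : int, subdivision A (hermite_samples (P k)) j =
                        2 ^- k *: hermite_samples (P k) j].

Definition fdiff (R : realType) (c : int -> R) : int -> R :=
  fun j => c (j + 1) - c j.

(* Unsigned Stirling numbers of the first kind. *)
Fixpoint stirling1 (n m : nat) : nat :=
  match n, m with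
  | 0, 0 => 1
  | 0, _.+1 => 0
  | _.+1, 0 => 0
  | n'.+1, m'.+1 => n' * stirling1 n' m'.+1 + stirling1 n' m'
  end%N.

Definition gregory_coef (R : realType) (n : nat) : R :=
  (n`!%:R)^-1 *
  \sum_(0 <= j < n.+1) (stirling1 n j)%:R * ((-1) ^+ (n - j) / j.+1%:R).

Definition gregory_op (R : realType) (n : nat) (c : int -> 'cV[R]_2) :
    int -> 'cV[R]_2 :=
  let c0 := fun j => c j 0 0 in
  let c1 := fun j => c j 1 0 in
  fun j => vec2
    (iter n (@fdiff R) c1 j)
    (fdiff c0 j - \sum_(0 <= l < n) gregory_coef R l * iter l (@fdiff R) c1 j).

(* Main.v *)
(** The kernel of the Gregory operator contains all samples [p; p'] with
    deg p <= n, because [p(x+1) - p(x)] is the integral of [p'] over one step,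
    which equals the Gregory series in the forward differences of [p'].  By the
    spectral condition, [G S_A] therefore annihilates these samples as well.
    For fixed [j], each row of [(G S_A c)_j] is a finite functional
    [alpha(c_0) + beta(c_1)].  Annihilating constants forces
    [alpha = b1 Delta]; then [beta + b1 (sum_l G_l Delta^l)] annihilates the
    polynomials of degree < n, so it equals [b0 Delta^n], and the functional
    is [b0] applied to the first component of [G c] plus [b1] applied to the
    second.  Shifting [c] by one shifts [G S_A c] by two, so the functionals
    at [j = 0] and [j = 1] determine the mask [B]. *)

Require Import Defs.
From HB Require Import structures.
From mathcomp Require Import all_boot all_order all_algebra.
From mathcomp Require Import classical_sets cardinality fsbigop reals.
From mathcomp Require Import zify ring.

Set Implicit Arguments.
Unset Strict Implicit.
Unset Printing Implicit Defensive.

Import Order.TTheory GRing.Theory Num.Theory.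
Local Open Scope ring_scope.

(** * Iterated forward differences of sequences *)

Lemma fdiff_iter_local (R : realType) l (c c' : int -> R) j :
    (forall k, j <= k <= j + l%:Z -> c k = c' k) ->
  iter l (@fdiff R) c j = iter l (@fdiff R) c' j.
Proof.
elim: l c c' => [|l IHl] c c' cc'; first by apply: cc'; lia.
rewrite !iterSr; apply: IHl => k hk; rewrite /fdiff !cc' //; lia.
Qed.

Lemma eq_fdiff_iter (R : realType) l (c c' : int -> R) :
  c =1 c' -> iter l (@fdiff R) c =1 iter l (@fdiff R) c'.
Proof. by move=> cc' j; apply: fdiff_iter_local => k _. Qed.

Lemma fdiff_iter_linear (R : realType) l a (c c' : int -> R) j :
  iter l (@fdiff R) (fun k => a * c k + c' k) j =
  a * iter l (@fdiff R) c j + iter l (@fdiff R) c' j.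
Proof. by elim: l j => [//|l IHl] j; rewrite !iterS {1}/fdiff !IHl /fdiff; ring. Qed.

Lemma fdiff_iter_shift (R : realType) l (c : int -> R) i j :
  iter l (@fdiff R) (fun k => c (k + i)) j = iter l (@fdiff R) c (j + i).
Proof. by elim: l j => [//|l IHl] j; rewrite !iterS {1}/fdiff !IHl /fdiff addrAC. Qed.

Definition samples (R : realType) (p : {poly R}) : int -> R :=
  fun k => p.[k%:~R].

Lemma fdiff_iter0 (R : realType) l j : iter l (@fdiff R) (fun=> 0) j = 0.
Proof. by elim: l j => [//|l IHl] j; rewrite iterS /fdiff !IHl subrr. Qed.

(** Subtracting the multiple of [P n] that cancels the coefficient of degree [n] lowers the size
    bound, which drives an induction on [n]. It serves both for the Newton basis and for the
    polynomials of the spectral condition. *)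
Lemma poly_triangular_ind (R : fieldType) (V : lmodType R) (f : {poly R} -> V)
    (P : nat -> {poly R}) n :
    (forall (a : R) (p q : {poly R}), f (a *: p + q) = a *: f p + f q) ->
    (forall k, (k < n)%N ->
      [/\ (size (P k) <= k.+1)%N, (P k)`_k != 0 & f (P k) = 0]) ->
  forall p : {poly R}, (size p <= n)%N -> f p = 0.
Proof.
move=> flin; elim: n => [|n IHn] hP p hp.
  (* The base case needs [f 0 = 0], which is linearity with factor -1 at zero. *)
  have := flin (-1) 0 0; rewrite scaler0 addr0 scaleN1r addNr.
  by move: hp; rewrite size_poly_leq0 => /eqP ->.
have [sP Pn0 fP] := hP n (ltnSn n).
pose q := p - (p`_n / (P n)`_n) *: P n.
have -> : p = (p`_n / (P n)`_n) *: P n + q by rewrite addrC subrK.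
rewrite flin fP scaler0 add0r IHn // => [k hk|]; first by apply: hP; apply: ltnW.
apply/leq_sizeP => j; rewrite leq_eqVlt => /orP[/eqP<-|nj].
  by rewrite coefB coefZ divfK // subrr.
have [pj Pj] : p`_j = 0 /\ (P n)`_j = 0.
  by split; apply: nth_default; apply: leq_trans _ nj.
by rewrite coefB coefZ pj Pj mulr0 subrr.
Qed.

(** * Falling factorials, Stirling numbers and the Newton basis *)

Definition falling_poly (R : realType) n : {poly R} :=
  \prod_(i < n) ('X - (i%:R)%:P).

Lemma stirling1_small n m : (n < m)%N -> stirling1 n m = 0%N.
Proof.
by elim: n m => [|n IHn] [|m] //=; rewrite ltnS => nm; rewrite !IHn ?muln0 //; lia.
Qed.

Lemma coef_falling_poly (R : realType) n j :
  (falling_poly R n)`_j = (-1) ^+ (n - j) * (stirling1 n j)%:R.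
Proof.
elim: n j => [|n IHn] j.
  by rewrite /falling_poly big_ord0 coef1 sub0n mul1r; case: j.
rewrite /falling_poly big_ord_recr /= -/(falling_poly R n) mulrBr.
rewrite coefB coefMX coefMC !IHn.
case: j => [|j] /=.
  rewrite subn0 sub0r; case: n {IHn} => [|n]; first by rewrite !mulr0 oppr0.
  by rewrite /= mulr0 mul0r oppr0 mulr0.
(* If [j < n], the two signs differ by one factor -1. Otherwise the exponent [n - j.+1] is
   truncated, but the Stirling number next to it vanishes. *)
rewrite subSS natrD natrM; case: (ltnP j n) => hj.
  have -> : (n - j = (n - j.+1).+1)%N by lia.
  by rewrite exprS; ring.
by rewrite (@stirling1_small n j.+1) //; ring.
Qed.

Lemma size_falling_poly (R : realType) n : size (falling_poly R n) = n.+1.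
Proof. by rewrite /falling_poly size_prod_XsubC /index_enum -enumT size_enum_ord. Qed.

(** The binomial coefficient [x] over [n], as a polynomial in [x]. *)
Definition newton_poly (R : realType) n : {poly R} :=
  (n`!%:R)^-1 *: falling_poly R n.

Lemma fact_neq0 (R : realType) n : n`!%:R != 0 :> R.
Proof. by rewrite pnatr_eq0 -lt0n fact_gt0. Qed.

Lemma size_newton_poly (R : realType) n : size (newton_poly R n) = n.+1.
Proof. by rewrite size_scale ?size_falling_poly // invr_eq0 fact_neq0. Qed.

Lemma coef_newton_poly_neq0 (R : realType) n : (newton_poly R n)`_n != 0.
Proof.
have := lead_coef_eq0 (newton_poly R n).
by rewrite lead_coefE -size_poly_eq0 size_newton_poly => ->.
Qed.

Lemma newton_poly0 (R : realType) : newton_poly R 0 = 1.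
Proof. by rewrite /newton_poly /falling_poly big_ord0 invr1 scale1r. Qed.

Lemma newton_poly_at0 (R : realType) n : (newton_poly R n).[0] = (n == 0%N)%:R.
Proof.
case: n => [|n]; first by rewrite newton_poly0 hornerC.
by rewrite hornerZ horner_prod big_ord_recl hornerXsubC subrr mul0r mulr0.
Qed.

(** Pascal's rule for binomial coefficients. *)
Lemma fdiff_newton_poly (R : realType) n :
  fdiff (samples (newton_poly R n.+1)) =1 samples (newton_poly R n).
Proof.
move=> k; rewrite /fdiff /samples !hornerZ.
set x := k%:~R; have -> : (k + 1)%:~R = x + 1 :> R by rewrite intrD.
have -> : (falling_poly R n.+1).[x] = (falling_poly R n).[x] * (x - n%:R).
  by rewrite /falling_poly big_ord_recr hornerM hornerXsubC.
(* The factor of index [i.+1] at [x + 1] is the factor of index [i] at [x]; the factor of index 0 is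
   left over as [x + 1]. *)
have -> : (falling_poly R n.+1).[x + 1] = (x + 1) * (falling_poly R n).[x].
  rewrite /falling_poly !horner_prod big_ord_recl hornerXsubC subr0; congr (_ * _).
  apply: eq_bigr => i _; rewrite !hornerXsubC lift0 -natr1; ring.
rewrite factS natrM invfM.
have : n.+1%:R != 0 :> R by rewrite pnatr_eq0.
rewrite -natr1; move: (n`!%:R^-1) ((falling_poly R n).[x]) => a b h; by field.
Qed.

Lemma fdiff_iter_newton_poly (R : realType) l m :
  iter l (@fdiff R) (samples (newton_poly R m)) =1
  if (l <= m)%N then samples (newton_poly R (m - l)) else fun=> 0.
Proof.
elim: l m => [|l IHl] m k; first by rewrite subn0.
rewrite iterSr; case: m => [|m].
  rewrite ltn0 -(fdiff_iter0 R l k); apply: eq_fdiff_iter => i.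
  by rewrite /fdiff /samples newton_poly0 !hornerC subrr.
by rewrite (eq_fdiff_iter _ (@fdiff_newton_poly R m)) IHl ltnS subSS.
Qed.

(** * Antiderivatives and Gregory quadrature *)

(** At [i = 0] the division by zero yields 0, so the constant term vanishes and [(primitive p).[1]]
    is the integral of [p] over [0, 1]. *)
Definition primitive (R : realType) (p : {poly R}) : {poly R} :=
  \poly_(i < (size p).+1) (p`_i.-1 / i%:R).

Lemma coef_primitive (R : realType) (p : {poly R}) i :
  (primitive p)`_i = p`_i.-1 / i%:R.
Proof.
rewrite coef_poly; case: ltnP => // hi; case: i hi => // i hi.
by rewrite nth_default ?mul0r.
Qed.

Lemma size_primitive (R : realType) (p : {poly R}) n :
  (size p <= n)%N -> (size (primitive p) <= n.+1)%N.
Proof. by move=> hp; apply: leq_trans (size_poly _ _) _. Qed.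

Lemma deriv_primitive (R : realType) (p : {poly R}) : (primitive p)^`() = p.
Proof.
apply/polyP => i; rewrite coef_deriv coef_primitive /= -[LHS]mulr_natr divfK //.
by rewrite pnatr_eq0.
Qed.

Lemma primitive_deriv (R : realType) (p : {poly R}) :
  primitive p^`() = p - (p`_0)%:P.
Proof.
apply/polyP => -[|i]; rewrite coef_primitive coefB coefC /=.
  by rewrite invr0 mulr0 subrr.
by rewrite coef_deriv -[p`__ *+ _]mulr_natr mulfK ?subr0 // pnatr_eq0.
Qed.

Lemma primitive_linear (R : realType) a (p q : {poly R}) :
  primitive (a *: p + q) = a *: primitive p + primitive q.
Proof.
apply/polyP => i.
by rewrite coefD coefZ !coef_primitive coefD coefZ mulrDl mulrA.
Qed.

(** Termwise integration: the signed Stirling coefficient of degree [j] gets divided by [j + 1]. *)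
Lemma gregory_coefE (R : realType) n :
  (primitive (newton_poly R n)).[1] = gregory_coef R n.
Proof.
rewrite (@horner_coef_wide _ n.+2) ?size_primitive ?size_newton_poly //.
rewrite big_ord_recl coef_primitive invr0 mulr0 mul0r add0r.
rewrite /gregory_coef mulr_sumr big_mkord; apply: eq_bigr => i _.
rewrite lift0 coef_primitive expr1n mulr1 coefZ coef_falling_poly /=; ring.
Qed.

(* On the Newton basis both sides reduce to [gregory_coef], the integral over
   [0, 1] of the binomial coefficient polynomial. *)
Lemma gregory_quadrature (R : realType) n (q : {poly R}) : (size q <= n)%N ->
  (primitive q).[1] =
  \sum_(0 <= l < n) gregory_coef R l * iter l (@fdiff R) (samples q) 0.
Proof.
move=> hq; apply/eqP; rewrite -subr_eq0; apply/eqP; move: q hq.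
apply: (@poly_triangular_ind R R^o _ (@newton_poly R)) => [a p q|m mn].
  rewrite -[RHS]/(a * (_ - _) + (_ - _)) primitive_linear hornerD hornerZ.
  rewrite mulrBr addrACA -opprD.
  congr (_ - _).
  rewrite mulr_sumr -big_split; apply: eq_bigr => l _ /=.
  rewrite [LHS](_ : _ = gregory_coef R l *
     iter l (@fdiff R) (fun k => a * samples p k + samples q k) 0).
    rewrite fdiff_iter_linear; ring.
  by congr (_ * _); apply: eq_fdiff_iter => k; rewrite /samples !hornerE.
split; rewrite ?size_newton_poly ?coef_newton_poly_neq0 //.
(* Only [l = m] contributes: the difference of order [l] is zero for [l > m], and for [l < m] it is
   the Newton polynomial of degree [m - l], which vanishes at 0. *)
rewrite gregory_coefE big_mkord (bigD1 (Ordinal mn)) //= big1 => [|i im].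
  rewrite fdiff_iter_newton_poly leqnn subnn /samples newton_poly0 hornerC.
  by rewrite mulr1 addr0 subrr.
rewrite fdiff_iter_newton_poly; case: leqP => hi; last by rewrite mulr0.
rewrite /samples newton_poly_at0 subn_eq0 leqNgt ltn_neqAle hi andbT.
by rewrite -val_eqE /= in im; rewrite im mulr0.
Qed.

Lemma fdiff_iter_samples_eq0 (R : realType) n (q : {poly R}) :
  (size q <= n)%N -> iter n (@fdiff R) (samples q) 0 = 0.
Proof.
move: q; apply: (@poly_triangular_ind R R^o _ (@newton_poly R)) => [a p q|m mn].
  rewrite /GRing.scale /= -fdiff_iter_linear.
  by apply: eq_fdiff_iter => k; rewrite /samples !hornerE.
split; rewrite ?size_newton_poly ?coef_newton_poly_neq0 //.
by rewrite fdiff_iter_newton_poly leqNgt mn.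
Qed.

(** * The Gregory operator: locality, linearity, shifts and kernel *)

Lemma vec2_00 (R : realType) (a b : R) : vec2 a b 0 0 = a.
Proof. by rewrite mxE. Qed.

Lemma vec2_10 (R : realType) (a b : R) : vec2 a b 1 0 = b.
Proof. by rewrite mxE. Qed.

Lemma cV2P (R : realType) (u v : 'cV[R]_2) :
  u 0 0 = v 0 0 -> u 1 0 = v 1 0 -> u = v.
Proof.
move=> h0 h1; apply/colP => -[[|[|//]] i].
  by rewrite (_ : Ordinal i = 0) //; apply: val_inj.
by rewrite (_ : Ordinal i = 1) //; apply: val_inj.
Qed.

Lemma gregory_op_local (R : realType) n (c c' : int -> 'cV[R]_2) j :
    (forall k, j <= k <= j + n.+1%:Z -> c k = c' k) ->
  gregory_op n c j = gregory_op n c' j.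
Proof.
move=> cc'; rewrite /gregory_op; congr vec2.
  by apply: fdiff_iter_local => k hk; rewrite cc' //; lia.
congr (_ - _); first by rewrite /fdiff !cc' //; lia.
rewrite !big_nat; apply: eq_bigr => l hl; congr (_ * _).
by apply: fdiff_iter_local => k hk; rewrite cc' //; lia.
Qed.

Lemma eq_gregory_op (R : realType) n (c c' : int -> 'cV[R]_2) :
  c =1 c' -> gregory_op n c =1 gregory_op n c'.
Proof. by move=> cc' j; apply: gregory_op_local => k _. Qed.

Lemma gregory_op_linear (R : realType) n a (c c' : int -> 'cV[R]_2) j :
  gregory_op n (fun k => a *: c k + c' k) j =
  a *: gregory_op n c j + gregory_op n c' j.
Proof.
have E s l i : iter l (@fdiff R) (fun k => (a *: c k + c' k) s 0) i =
    a * iter l (@fdiff R) (fun k => c k s 0) i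
    + iter l (@fdiff R) (fun k => c' k s 0) i.
  by rewrite -fdiff_iter_linear; apply: eq_fdiff_iter => k; rewrite !mxE.
apply: cV2P; rewrite /gregory_op ?(mxE, vec2_00, vec2_10) /=; first exact: E.
rewrite [fdiff _ _](E 0 1%N) /=; move: (fdiff _ j) => x; move: (fdiff _ j) => y.
rewrite mulrBr addrACA -opprD mulr_sumr -big_split; congr (_ - _).
by apply: eq_bigr => l _ /=; rewrite E; ring.
Qed.

Lemma gregory_op_scale (R : realType) n a (c : int -> 'cV[R]_2) j :
  gregory_op n (fun k => a *: c k) j = a *: gregory_op n c j.
Proof.
(* This splitting turns a scalar multiple into an instance of [gregory_op_linear]. *)
have split_scale (v : 'cV[R]_2) : a *: v = (a - 1) *: v + v.
  by rewrite -[X in _ + X]scale1r -scalerDl subrK.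
rewrite [RHS]split_scale -gregory_op_linear.
by apply: eq_gregory_op => k; exact: split_scale.
Qed.

Lemma gregory_op_shift (R : realType) n (c : int -> 'cV[R]_2) i j :
  gregory_op n (fun k => c (k + i)) j = gregory_op n c (j + i).
Proof.
rewrite /gregory_op; congr vec2; first exact: (fdiff_iter_shift n (fun k => c k 1 0)).
congr (_ - _); first exact: (fdiff_iter_shift 1 (fun k => c k 0 0)).
by apply: eq_bigr => l _; rewrite (fdiff_iter_shift l (fun k => c k 1 0)).
Qed.

Lemma hermite_samples_linear (R : realType) a (p q : {poly R}) k :
  hermite_samples (a *: p + q) k =
  a *: hermite_samples p k + hermite_samples q k.
Proof.
by apply: cV2P; rewrite /hermite_samples ?(mxE, vec2_00, vec2_10) ?derivE !hornerE.
Qed.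

(** Translating [p] by [j] reduces to position 0. There the first row is the [n]-th difference of a
    polynomial of degree below [n], and the second row is the quadrature formula for the
    derivative. *)
Lemma gregory_op_hermite_samples (R : realType) n (p : {poly R}) j :
  (size p <= n.+1)%N -> gregory_op n (hermite_samples p) j = 0.
Proof.
move=> hp; rewrite -[j]add0r -gregory_op_shift.
pose q := p \Po ('X + (j%:~R)%:P).
have hq : (size q <= n.+1)%N by rewrite size_comp_poly2 ?size_XaddC.
have hq' : (size q^`() <= n)%N.
  by apply: leq_trans (size_poly _ _) _; move: hq; case: (size q).
have -> : gregory_op n (fun k => hermite_samples p (k + j)) 0 =
    gregory_op n (hermite_samples q) 0.
  apply: eq_gregory_op => k; rewrite /hermite_samples.
  by rewrite /q deriv_comp !derivE addr0 mulr1 !horner_comp !hornerE intrD.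
rewrite /gregory_op; apply: cV2P; rewrite ?vec2_00 ?vec2_10 mxE.
  rewrite -(fdiff_iter_samples_eq0 hq'); apply: eq_fdiff_iter => k.
  by rewrite vec2_10.
apply/eqP; rewrite subr_eq0; apply/eqP; rewrite {1}/fdiff !vec2_00 add0r.
have -> : q.[1%:~R] - q.[0%:~R] = (primitive q^`()).[1].
  by rewrite primitive_deriv hornerD hornerN hornerC horner_coef0.
rewrite (gregory_quadrature hq'); apply: eq_bigr => l _; congr (_ * _).
by apply: eq_fdiff_iter => k; rewrite vec2_10.
Qed.

(** * Finite functionals on scalar sequences *)

(* Weights are stored as the coefficients of a polynomial, so that [w * 'X]
   shifts the sequence and [w * ('X - 1)] takes its forward difference. *)
Definition weighted_sum (R : realType) (N : nat) (w : {poly R}) (c : int -> R) : R :=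
  \sum_(i < size w) w`_i * c (i%:Z - N%:Z).

Lemma weighted_sum_widen (R : realType) N (w : {poly R}) m (c : int -> R) :
    (size w <= m)%N ->
  weighted_sum N w c = \sum_(i < m) w`_i * c (i%:Z - N%:Z).
Proof.
move=> hm; rewrite /weighted_sum.
rewrite (big_ord_widen m (fun i : nat => w`_i * c (i%:Z - N%:Z)) hm) big_mkcond.
by apply: eq_bigr => i _; case: ltnP => // hi; rewrite nth_default ?mul0r.
Qed.

Lemma eq_weighted_sum (R : realType) N (w : {poly R}) (c c' : int -> R) :
  c =1 c' -> weighted_sum N w c = weighted_sum N w c'.
Proof. by move=> cc'; apply: eq_bigr => i _; rewrite cc'. Qed.

Lemma weighted_sumD (R : realType) N (v w : {poly R}) (c : int -> R) :
  weighted_sum N (v + w) c = weighted_sum N v c + weighted_sum N w c.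
Proof.
set m := maxn (size v) (size w).
rewrite !(@weighted_sum_widen _ _ _ m) ?size_polyD ?leq_maxl ?leq_maxr //.
by rewrite -big_split; apply: eq_bigr => i _; rewrite coefD mulrDl.
Qed.

Lemma weighted_sumZ (R : realType) N a (w : {poly R}) (c : int -> R) :
  weighted_sum N (a *: w) c = a * weighted_sum N w c.
Proof.
rewrite (@weighted_sum_widen _ _ _ (size w)) ?size_scale_leq // mulr_sumr.
by apply: eq_bigr => i _; rewrite coefZ mulrA.
Qed.

Lemma weighted_sum_linear (R : realType) N (w : {poly R}) a (c c' : int -> R) :
  weighted_sum N w (fun k => a * c k + c' k) =
  a * weighted_sum N w c + weighted_sum N w c'.
Proof.
by rewrite mulr_sumr -big_split; apply: eq_bigr => i _ /=; ring.
Qed.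

Lemma weighted_sumMX (R : realType) N (w : {poly R}) (c : int -> R) :
  weighted_sum N (w * 'X) c = weighted_sum N w (fun k => c (k + 1)).
Proof.
rewrite (@weighted_sum_widen _ _ _ (size w).+1); last first.
  by rewrite (leq_trans (size_polyMleq _ _)) // size_polyX addn2.
rewrite big_ord_recl coefMX mul0r add0r; apply: eq_bigr => i _.
by rewrite coefMX lift0 /=; congr (_ * c _); lia.
Qed.

Lemma weighted_sumMXsub1 (R : realType) N (w : {poly R}) (c : int -> R) :
  weighted_sum N (w * ('X - 1)) c = weighted_sum N w (fdiff c).
Proof.
rewrite mulrBr mulr1 weighted_sumD weighted_sumMX -scaleN1r weighted_sumZ addrC.
by rewrite -weighted_sum_linear; apply: eq_weighted_sum => k; rewrite /fdiff; ring.
Qed.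

Lemma weighted_sumMXsub1_exp (R : realType) N (w : {poly R}) l (c : int -> R) :
  weighted_sum N (w * ('X - 1) ^+ l) c = weighted_sum N w (iter l (@fdiff R) c).
Proof.
elim: l w c => [|l IHl] w c; first by rewrite mulr1.
by rewrite exprSr mulrA weighted_sumMXsub1 IHl iterSr.
Qed.

Lemma weighted_sum_cst (R : realType) N (w : {poly R}) :
  weighted_sum N w (fun=> 1) = w.[1].
Proof.
by rewrite horner_coef; apply: eq_bigr => i _; rewrite expr1n.
Qed.

(** Annihilating constants makes 1 a root of [w]. By Pascal's rule the quotient by ['X - 1] acts on
    the Newton polynomial of degree [m] as [w] does on that of degree [m + 1], so the quotient
    inherits the hypothesis for [n - 1]. *)
Lemma weighted_sum_annihilates_poly (R : realType) N n (w : {poly R}) :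
    (forall m, (m < n)%N -> weighted_sum N w (samples (newton_poly R m)) = 0) ->
  exists v, w = v * ('X - 1) ^+ n.
Proof.
elim: n w => [|n IHn] w hw; first by exists w; rewrite mulr1.
have /factor_theorem[u wu] : root w 1.
  rewrite /root -(weighted_sum_cst N) -(hw 0%N) //; apply/eqP.
  by apply: eq_weighted_sum => k; rewrite /samples newton_poly0 hornerC.
have [m mn|v uv] := IHn u.
  rewrite -(hw m.+1) // wu polyC1 weighted_sumMXsub1.
  by apply: eq_weighted_sum => k; rewrite fdiff_newton_poly.
by exists v; rewrite wu uv polyC1 exprSr mulrA.
Qed.

(** The weights are the values of [f] on the unit sequences of the window from [-N] to [N]. *)
Lemma local_linear_weighted_sum (R : realType) N (f : (int -> R) -> R) :
    (forall a c c', f (fun k => a * c k + c' k) = a * f c + f c') ->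
    (forall c c' : int -> _, (forall k : int, - N%:Z <= k <= N%:Z -> c k = c' k) ->
      f c = f c') ->
  exists w, forall c, f c = weighted_sum N w c.
Proof.
move=> flin floc.
pose delta i : int -> R := fun k => (k == i%:Z - N%:Z)%R%:R.
exists (\poly_(i < N.*2.+1) f (delta i)) => c.
rewrite (@weighted_sum_widen _ _ _ N.*2.+1) ?size_poly //.
(* [cut m] keeps the first [m] entries of the window. Going to [cut m.+1] adds one multiple of
   [delta m], and [cut N.*2.+1] agrees with [c] on the whole window. *)
pose cut m : int -> R := fun k => (k < m%:Z - N%:Z)%R%:R * (- N%:Z <= k)%R%:R * c k.
have f0 : f (fun=> 0) = 0.
  have := flin (-1) (fun=> 0) (fun=> 0); rewrite [X in _ = X + _]mulN1r [RHS]addNr => h.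
  rewrite -[RHS]h.
  by apply: floc => k _; rewrite mulr0 addr0.
have H m : f (cut m) = \sum_(i < m) f (delta i) * c (i%:Z - N%:Z).
  elim: m => [|m IHm].
    rewrite big_ord0 -f0; apply: floc => k hk; rewrite /cut.
    by rewrite (_ : (_ < _) = false) ?mul0r //; lia.
  rewrite big_ord_recr /= -IHm addrC mulrC -flin; apply: floc => k hk.
  rewrite /cut /delta; case: (eqVneq k (m%:Z - N%:Z)) => [->|kn].
    rewrite mulr1 ltxx !mul0r addr0 (_ : (_ < _) = true); last by lia.
    by rewrite (_ : (_ <= _) = true) ?mul1r //; lia.
  rewrite mulr0 add0r; congr (_%:R * _ * _); congr nat_of_bool; lia.
rewrite -[LHS](_ : f (cut N.*2.+1) = _); last first.
  apply: floc => k /andP[h1 h2]; rewrite /cut h1.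
  by rewrite (_ : (_ < _) = true) ?mul1r //; lia.
by rewrite H; apply: eq_bigr => i _; rewrite coef_poly ltn_ord.
Qed.

(** * Factoring annihilating functionals through the Gregory operator *)

(** In terms of weight polynomials, ['X - 1] must divide [alpha], and [('X - 1) ^+ n] must divide
    [beta] corrected by the Gregory series. Both follow from testing [f] on polynomial samples. *)
Lemma gregory_factor_functional (R : realType) n N (f : (int -> 'cV[R]_2) -> R) :
    (forall a c c', f (fun k => a *: c k + c' k) = a * f c + f c') ->
    (forall c c' : int -> _, (forall k : int, - N%:Z <= k <= N%:Z -> c k = c' k) ->
      f c = f c') ->
    (forall p : {poly R}, (size p <= n.+1)%N -> f (hermite_samples p) = 0) ->
  exists b0 b1 : {poly R}, forall c, f c =
    weighted_sum N b0 (fun k => gregory_op n c k 0 0)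
    + weighted_sum N b1 (fun k => gregory_op n c k 1 0).
Proof.
move=> flin floc fann.
have [|c c' cc'|alpha hal] :=
  @local_linear_weighted_sum R N (fun c => f (fun k => vec2 (c k) 0)).
- move=> a c c'; rewrite -flin; apply: floc => k _.
  by apply: cV2P; rewrite !mxE //= mulr0 addr0.
- by apply: floc => k hk; rewrite cc'.
have [|c c' cc'|beta hbe] :=
  @local_linear_weighted_sum R N (fun c => f (fun k => vec2 0 (c k))).
- move=> a c c'; rewrite -flin; apply: floc => k _.
  by apply: cV2P; rewrite !mxE //= mulr0 addr0.
- by apply: floc => k hk; rewrite cc'.
have fE c : f c = weighted_sum N alpha (fun k => c k 0 0)
                  + weighted_sum N beta (fun k => c k 1 0).
  rewrite -hal -hbe -[X in X + _]mul1r -flin; apply: floc => k _.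
  by apply: cV2P; rewrite !mxE /= mul1r ?addr0 ?add0r.
have fhE p : f (hermite_samples p) = weighted_sum N alpha (samples p)
                                     + weighted_sum N beta (samples p^`()).
  by rewrite fE; congr (_ + _); apply: eq_weighted_sum => k; rewrite mxE.
(* The samples of the polynomial 1 have zero second component, so only [alpha] sees them. *)
have /factor_theorem[b1 alE] : root alpha 1.
  have := fann 1; rewrite fhE size_poly1 => /(_ isT) h.
  rewrite /root -(weighted_sum_cst N); apply/eqP; rewrite -[RHS]h.
  rewrite derivE (_ : weighted_sum N beta _ = 0) ?addr0.
    by apply: eq_weighted_sum => k; rewrite /samples hornerC.
  by rewrite /weighted_sum big1 // => i _; rewrite /samples horner0 mulr0.
rewrite polyC1 in alE.
pose g c k := \sum_(0 <= l < n) gregory_coef R l * iter l (@fdiff R) c k.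
(* Adding the Gregory series to [beta] compensates for the one subtracted in the second row of the
   operator, to which [b1] is applied. *)
pose gamma := beta + b1 * \sum_(l < n) gregory_coef R l *: ('X - 1) ^+ l.
have gaE c : weighted_sum N gamma c = weighted_sum N beta c + weighted_sum N b1 (g c).
  rewrite weighted_sumD; congr (_ + _); rewrite /g; elim: n {fann g gamma} => [|m IHm].
    rewrite big_ord0 mulr0 /weighted_sum size_poly0 big_ord0 big1 // => i _.
    by rewrite big_geq ?mulr0.
  rewrite big_ord_recr mulrDr weighted_sumD IHm -scalerAr weighted_sumZ.
  rewrite weighted_sumMXsub1_exp addrC -weighted_sum_linear.
  by apply: eq_weighted_sum => k; rewrite big_nat_recr //= addrC.
(* The test polynomials are antiderivatives of Newton polynomials of degree [m < n]. The kernel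
   property replaces the Gregory sum of the derivative by the difference of the antiderivative, so
   [gamma] on the Newton polynomial equals [f] on the samples, which is 0. *)
have [m mn|b0 ga] := @weighted_sum_annihilates_poly R N n gamma.
  have hp : (size (primitive (newton_poly R m)) <= n.+1)%N.
    by apply: size_primitive; rewrite size_newton_poly.
  rewrite gaE -[RHS](fann _ hp) fhE deriv_primitive addrC; congr (_ + _).
  rewrite alE weighted_sumMXsub1; apply: eq_weighted_sum => k.
  have := gregory_op_hermite_samples k hp => /(congr1 (fun v : 'cV[R]_2 => v 1 0)).
  rewrite /gregory_op vec2_10 mxE => /eqP; rewrite subr_eq0 => /eqP h.
  rewrite -[RHS](_ : fdiff (fun j => hermite_samples (primitive (newton_poly R m)) j 0 0) k = _).
    rewrite h; apply: eq_bigr => l _; congr (_ * _); apply: eq_fdiff_iter => i.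
    by rewrite vec2_10 deriv_primitive.
  by rewrite /fdiff !vec2_00.
exists b0, b1 => c; rewrite fE alE weighted_sumMXsub1.
have -> : weighted_sum N beta (fun k => c k 1 0) =
    weighted_sum N gamma (fun k => c k 1 0) - weighted_sum N b1 (g (fun k => c k 1 0)).
  by rewrite gaE addrK.
rewrite ga weighted_sumMXsub1_exp addrCA; congr (_ + _).
  by apply: eq_weighted_sum => k; rewrite vec2_00.
rewrite addrC -mulN1r -weighted_sum_linear; apply: eq_weighted_sum => k.
by rewrite vec2_10 mulN1r addrC.
Qed.

(** * Finite sums over the integers and the subdivision operator *)

Lemma fsum_int_window (V : zmodType) (F : int -> V) (lo : int) (m : nat) :
    (forall k, ~~ (lo <= k < lo + m%:Z) -> F k = 0) ->
  \sum_(k \in [set: int]) F k = \sum_(i < m) F (lo + i%:Z).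
Proof.
move=> F0; pose r := [seq lo + i%:Z | i <- index_iota 0 m].
rewrite (@fsbigE _ _ _ _ _ r).
- rewrite big_map big_mkord.
  by apply: eq_bigl => i; rewrite in_setT.
- by rewrite map_inj_uniq ?iota_uniq // => x y; lia.
- by [].
move=> k _ kr; apply: F0; apply: contra kr => hk; apply/mapP.
by exists `|k - lo|%N; rewrite ?mem_index_iota; lia.
Qed.

Lemma finitely_supported_bound (R : realType) (A : int -> 'M[R]_2) :
  finitely_supported A -> exists N : nat, forall j, (N < `|j|)%N -> A j = 0.
Proof.
move=> /finite_seqP[s As]; exists (\max_(x <- s) `|x|%N) => j hj.
apply/eqP; apply: contraTT hj => Aj; rewrite -leqNgt.
have js : j \in s by have : [set` s]%classic j by rewrite -As.
by rewrite (big_rem j js) leq_maxl.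
Qed.

Lemma bound_finitely_supported (R : realType) (A : int -> 'M[R]_2) (N : nat) :
  (forall j, (N < `|j|)%N -> A j = 0) -> finitely_supported A.
Proof.
move=> A0; apply: (@sub_finite_set _ _ [set` [seq i%:Z - N%:Z | i <- iota 0 N.*2.+1]]%classic).
  move=> j; rewrite /mkset => Aj; apply/mapP; exists `|(j + N%:Z)%R|%N.
    rewrite mem_iota; move: Aj; case: (leqP `|j| N) => [|/A0 ->]; last by rewrite eqxx.
    lia.
  by move: Aj; case: (leqP `|j| N) => [|/A0 ->]; [lia | rewrite eqxx].
exact: finite_seq.
Qed.

(** If [|k| > M], then [|j - 2k| >= 2|k| - |j| > N], so the mask vanishes outside the window. *)
Lemma subdivisionE (R : realType) (A : int -> 'M[R]_2) (N M : nat) c j :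
    (forall j, (N < `|j|)%N -> A j = 0) -> (`|j| + N <= M)%N ->
  subdivision A c j =
  \sum_(i < M.*2.+1) A (j - 2 * (- M%:Z + i%:Z)) *m c (- M%:Z + i%:Z).
Proof.
move=> A0 jM; apply: (@fsum_int_window _ (fun k => A (j - 2 * k) *m c k)) => k hk.
by rewrite A0 ?mul0mx //; lia.
Qed.

Lemma subdivision_linear (R : realType) (A : int -> 'M[R]_2) a c c' j :
    finitely_supported A ->
  subdivision A (fun k => a *: c k + c' k) j =
  a *: subdivision A c j + subdivision A c' j.
Proof.
move=> /finitely_supported_bound[N A0]; rewrite !(subdivisionE _ A0 (leqnn _)).
rewrite scaler_sumr -big_split; apply: eq_bigr => i _.
by rewrite mulmxDr -scalemxAr.
Qed.

Lemma subdivision_local (R : realType) (A : int -> 'M[R]_2) N (c c' : int -> 'cV[R]_2) j :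
    (forall j, (N < `|j|)%N -> A j = 0) ->
    (forall k, (`|k| <= `|j| + N)%N -> c k = c' k) ->
  subdivision A c j = subdivision A c' j.
Proof.
move=> A0 cc'; rewrite !(subdivisionE _ A0 (leqnn _)); apply: eq_bigr => i _.
by rewrite cc' //; have := ltn_ord i; lia.
Qed.

(** Reindexing by [k + i], since [j + 2i - 2(k + i) = j - 2k]. *)
Lemma subdivision_shift (R : realType) (A : int -> 'M[R]_2) c i j :
  subdivision A (fun k => c (k + i)) j = subdivision A c (j + 2 * i).
Proof.
have hbij : bijective (fun k : int => k + i).
  by exists (fun k => k - i) => k; rewrite ?addrK ?subrK.
rewrite /subdivision [RHS](reindex_fsbigT _ _ hbij); apply: eq_fsbigr => k _.
by congr (A _ *m _); ring.
Qed.

(** * Matrix weights and the mask of the derived scheme *)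

Lemma gregory_factor (R : realType) n N (f : (int -> 'cV[R]_2) -> 'cV[R]_2) :
    (forall a c c', f (fun k => a *: c k + c' k) = a *: f c + f c') ->
    (forall c c' : int -> _, (forall k : int, - N%:Z <= k <= N%:Z -> c k = c' k) ->
      f c = f c') ->
    (forall p : {poly R}, (size p <= n.+1)%N -> f (hermite_samples p) = 0) ->
  exists2 W : int -> 'M[R]_2, finitely_supported W &
    forall c, f c = \sum_(k \in [set: int]) W k *m gregory_op n c k.
Proof.
move=> flin floc fann.
have row s : exists b0 b1 : {poly R}, forall c, f c s 0 =
    weighted_sum N b0 (fun k => gregory_op n c k 0 0)
    + weighted_sum N b1 (fun k => gregory_op n c k 1 0).
  apply: gregory_factor_functional => [a c c'|c c' cc'|p hp]; first by rewrite flin !mxE.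
    by rewrite (floc c c').
  by rewrite fann // mxE.
have [b00 [b01 h0]] := row 0; have [b10 [b11 h1]] := row 1.
pose b (s t : 'I_2) := if s == 0 then if t == 0 then b00 else b01
                       else if t == 0 then b10 else b11.
(* The weight at position [k] is the coefficient of index [k + N]. The test on [k] keeps the
   absolute value from folding positions below [-N] back onto actual coefficients. *)
pose W (k : int) : 'M[R]_2 :=
  \matrix_(s, t) if - N%:Z <= k then (b s t)`_`|(k + N%:Z)%R|%N else 0.
pose m := (size b00 + size b01 + size b10 + size b11)%N.
have bm s t : (size (b s t) <= m)%N.
  by rewrite /b /m; case: ifP => _; case: ifP => _; lia.
have W0 k : ~~ (- N%:Z <= k < - N%:Z + m%:Z) -> W k = 0.
  move=> hk; apply/matrixP => s t; rewrite !mxE; case: ifP => // hN.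
  by apply: nth_default; apply: leq_trans (bm s t) _; lia.
exists W.
  by apply: (@bound_finitely_supported _ _ (N + m)) => j hj; apply: W0; lia.
move=> c; rewrite (@fsum_int_window _ _ (- N%:Z) m) => [|k hk]; last first.
  by rewrite W0 ?mul0mx.
have E s : (\sum_(i < m) W (- N%:Z + i%:Z) *m gregory_op n c (- N%:Z + i%:Z)) s 0
    = weighted_sum N (b s 0) (fun k => gregory_op n c k 0 0)
    + weighted_sum N (b s 1) (fun k => gregory_op n c k 1 0).
  rewrite !(weighted_sum_widen _ _ (bm _ _)) -big_split summxE; apply: eq_bigr => i _.
  rewrite mxE !big_ord_recl big_ord0 addr0 !mxE lerDl lez_nat leq0n /=.
  rewrite (addrC (- N%:Z)) subrK absz_nat.
  by rewrite (_ : lift _ _ = 1) //; apply: val_inj.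
by apply: cV2P; rewrite E ?h0 ?h1.
Qed.

Theorem theorem1 (R : realType) (d : nat) (hd : (1 <= d)%N)
    (A : int -> 'M[R]_2) (hA : finitely_supported A)
    (hspec : spectral_condition A d) :
  forall n : nat, (1 <= n <= d)%N ->
    exists B : int -> 'M[R]_2,
      finitely_supported B /\
      forall (c : int -> 'cV[R]_2) (j : int),
        gregory_op n (subdivision A c) j =
        2 ^- n *: subdivision B (gregory_op n c) j.
Proof.
move=> n /andP[_ nd]; have [N A0] := finitely_supported_bound hA.
pose T c j := gregory_op n (subdivision A c) j.
have Tlin a c c' j : T (fun k => a *: c k + c' k) j = a *: T c j + T c' j.
  rewrite -gregory_op_linear; apply: eq_gregory_op => k.
  exact: subdivision_linear.
have Tann j (p : {poly R}) : (size p <= n.+1)%N -> T (hermite_samples p) j = 0.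
  have [P hP] := hspec; move: p.
  (* The polynomials [P k] with [k <= n] have exact degree [k]. Subdivision scales their samples by
     [2 ^- k], and the Gregory operator kills the result. *)
  apply: (@poly_triangular_ind R _ _ P) => [a p q|k kn].
    rewrite -Tlin; apply: eq_gregory_op => k; congr (subdivision A _ _).
    by apply: boolp.funext => i; exact: hermite_samples_linear.
  have [sP Pk SP] := hP k (leq_trans (n := n) kn nd).
  split=> //; first by rewrite Pk invr_eq0 fact_neq0.
  by rewrite /T (eq_gregory_op n SP) gregory_op_scale
    gregory_op_hermite_samples ?scaler0 ?(leq_trans sP).
(* The Gregory operator at [e] reads positions from [e] to [e + n + 1], hence at most [n + 2].
   Subdivision at such a position reads entries of absolute index at most [N + n + 2]. *)
have Tloc e (he : 0 <= e <= 1) c c' :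
    (forall k, - (N + n.+2)%:Z <= k <= (N + n.+2)%:Z -> c k = c' k) ->
    T c e = T c' e.
  move=> cc'; apply: gregory_op_local => k hk; apply: subdivision_local A0 _ => i hi.
  by apply: cc'; lia.
(* The factor [2 ^+ n] goes into the weights, so that [B] comes out with the normalization [2 ^- n]
   in front. *)
have Twgt e (he : 0 <= e <= 1) : exists2 W : int -> 'M[R]_2, finitely_supported W &
    forall c, 2 ^+ n *: T c e = \sum_(k \in [set: int]) W k *m gregory_op n c k.
  apply: (@gregory_factor R n (N + n.+2)) => [a c c'|c c' cc'|p hp].
  - by rewrite Tlin scalerDr !scalerA mulrC.
  - by rewrite (Tloc e he c c').
  by rewrite Tann ?scaler0.
have [W0 fW0 hW0] := Twgt 0 isT; have [W1 fW1 hW1] := Twgt 1 isT.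
pose W (e : int) := if e == 0 then W0 else W1.
have hW (e : int) : 0 <= e <= 1 -> forall c,
    2 ^+ n *: T c e = \sum_(k \in [set: int]) W e k *m gregory_op n c k.
  by move=> he c; have [->|->] : e = 0 \/ e = 1 by lia.
(* Even entries of [B] come from [j = 0], odd ones from [j = 1]:
   [B (e - 2 k) = W e k]. *)
pose B m := W (m %% 2)%Z (- (m %/ 2)%Z).
exists B; split.
  have [N0 b0] := finitely_supported_bound fW0.
  have [N1 b1] := finitely_supported_bound fW1.
  apply: (@bound_finitely_supported _ _ (2 * (N0 + N1) + 2)) => m hm.
  by rewrite /B /W; case: eqP => _; [apply: b0 | apply: b1]; lia.
move=> c j; pose e := (j %% 2)%Z; pose i := (j %/ 2)%Z.
have -> : j = e + 2 * i by rewrite /e /i {1}(divz_eq j 2) addrC mulrC.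
have he : 0 <= e <= 1 by rewrite /e; lia.
(* The even part [2 * i] of the position is moved onto the sequences on both sides, where it becomes
   a shift of [c] by [i]; only the residue [e] remains. *)
rewrite -gregory_op_shift -subdivision_shift.
have -> : gregory_op n (fun k => subdivision A c (k + 2 * i)) e = T (fun k => c (k + i)) e.
  by apply: eq_gregory_op => k; rewrite subdivision_shift.
have two_n : (2 : R) ^+ n != 0 by rewrite expf_neq0 ?pnatr_eq0.
rewrite -[LHS](scalerK two_n) hW //.
congr (_ *: _); rewrite /subdivision; apply: eq_fsbigr => k _.
rewrite gregory_op_shift; congr (_ *m _).
by rewrite /B; congr (W _ _); lia.
Qed.
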